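(* Consider the edge-breeding branching random walk with parameter $\lambda$ on the regular tree $\mathbb{T}_3$, with $\lambda \in (\lambda_w, \lambda_s]$, where $\lambda_w = 1/3$ and $\lambda_s = 1/(2\sqrt{2})$. If $I_1, I_2 \subseteq \mathbb{N} \setminus \{0\}$ are such that $\sum_{i \in I_1} 2^{-i} \ne \sum_{i \in I_2} 2^{-i}$, then $$\mathbf{q}\Big(\cdot, \bigcup_{i \in I_1} T_{x_i}\Big) \ne \mathbf{q}\Big(\cdot, \bigcup_{i \in I_2} T_{x_i}\Big).$$
   Context: $\mathbb{N}=\{0,1,2,\dots\}$. $\mathbb{T}_3$ is the infinite tree in which every vertex has exactly 3 neighbors, with natural distance $d$ and a fixed vertex $o$ called the root. The process. In the continuous-time edge-breeding branching random walk (BRW) on $\mathbb{T}_3$ with parameter $\lambda > 0$, each particle lives an exponential time of parameter 1 and, while alive, a particle at $x$ gives birth to a child at each neighbor $y$ of $x$ at the times of an independent Poisson process of rate $\lambda$; all particles behave independently. The process considered is its discrete-time counterpart $\{\eta_n\}_{n\in\mathbb{N}}$: generation $0$ consists of the initial particles, generation $n+1$ consists of the children of all the particles of generation $n$ (with their positions), and $\eta_n(x)$ is the number of generation-$n$ particles at $x$. Equivalently, it is the discrete-time BRW in which each particle at $x$ is independently replaced by a random finite offspring configuration with generating function $G(\mathbf{z}|x) = \big(1 + \lambda \sum_{y \sim x}(1 - \mathbf{z}(y))\big)^{-1}$, $\mathbf{z}\in[0,1]^{\mathbb{T}_3}$. $\mathbb{P}^{\delta_x}$ is the law started from one particle at $x$.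 Critical parameters. $\lambda_w$ (global) is the infimum of the $\lambda > 0$ for which the process survives (is never empty) with positive probability, and $\lambda_s$ (local) is the infimum of the $\lambda > 0$ for which a given vertex is occupied at arbitrarily large times with positive probability. For this BRW $\lambda_w = 1/3 < 1/(2\sqrt{2}) = \lambda_s$. Extinction probabilities. For $A \subseteq \mathbb{T}_3$, $\mathbf{q}(x,A) := 1 - \mathbb{P}^{\delta_x}\big(\limsup_{n \to \infty} \sum_{y \in A} \eta_n(y) > 0\big)$. Subtrees. For $x \ne o$, $T_x$ is the subtree branching from $x$: the set of vertices $w$ such that the path from $o$ to $w$ passes through $x$ (including $x$ itself); $T_o := \mathbb{T}_3$. Fix a sequence $\{y_n\}_{n \in \mathbb{Z}}$ of distinct vertices such that $y_n$ is a neighbor of $y_{n+1}$ for all $n$ and $d(o,y_n) = |n|$ (so $y_0 = o$). For $i \ge 1$, $x_i$ denotes the third neighbor of $y_{i-1}$, i.e. the neighbor different from $y_{i-2}$ and $y_i$. *)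

(* Defs.v *)
From HB Require Import structures.
From mathcomp Require Import all_boot all_order all_algebra.
From mathcomp Require Import finmap multiset.
From mathcomp Require Import all_classical all_reals all_analysis.

Set Implicit Arguments.
Unset Strict Implicit.
Unset Printing Implicit Defensive.

Import Order.TTheory GRing.Theory Num.Theory.

Local Open Scope classical_set_scope.
Local Open Scope ring_scope.

Section Tree.
Variables (V : countType) (adj : rel V).

(* [is_T3] says that the graph [adj] is (a copy of) the regular tree T_3:
   a connected acyclic simple graph all of whose vertices have exactly three
   neighbors.  The size condition in the last clause excludes the closed walks
   x - y - x, which are [ucycle]s of size 2; loops are excluded by
   irreflexivity. *)
Definition is_T3 : Prop :=
  [/\ symmetric adj,
      irreflexive adj,
      forall x, exists s : seq V,
        [/\ uniq s, size s = 3%N & forall y, (y \in s) = adj x y],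
      forall x y, exists p : seq V, path adj x p /\ last x p = y &
      forall c : seq V, (2 < size c)%N -> ~ ucycle adj c].

Definition is_dist (x y : V) (k : nat) : Prop :=
  (exists p : seq V, [/\ path adj x p, last x p = y & size p = k]) /\
  (forall p : seq V, path adj x p -> last x p = y -> (k <= size p)%N).

(* The vertices w such that the (simple) path from o to w passes through x.
   For x = o this is the whole tree, in accordance with the convention on T_o. *)
Definition subtree (o x : V) : set V :=
  [set w | exists p : seq V,
     [/\ path adj o p, uniq (o :: p), last o p = w & x \in o :: p]].

End Tree.

(* A finite configuration of particles is a finite multiset of vertices:
   [c y] is the number of particles of [c] located at [y], and [finsupp c] is
   the finite set of occupied vertices. *)
Notation config V := {mset V}%mset.

Section BranchingRandomWalk.
Variables (R : realType) (V : countType) (adj : rel V).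
Variables (d : measure_display) (Omega : measurableType d).
Variable P : probability Omega R.

(* A family of offspring configurations: [f (n, i, x)] is the configuration of
   the children of the [i]-th particle at [x] in generation [n]. *)
Implicit Types f : nat * nat * V -> Omega -> config V.

(* The generating function 1 / (1 + lam * sum_(y ~ x) (1 - z(y))) of the
   offspring law at x of the edge-breeding BRW. *)
Definition edge_breeding_gf (lam : R) (z : V -> R) (x : V) : R :=
  (1 + lam * \sum_(y \in [set y | adj x y]) (1 - z y))^-1.

Definition config_weight (z : V -> R) (c : config V) : R :=
  \prod_(y <- finsupp c) z y ^+ c y.

(* [config V] is countable and carries the discrete sigma-algebra, whence the
   quantification over arbitrary sets of configurations. *)
Definition measurable_family f : Prop :=
  forall k (B : set (config V)), measurable (f k @^-1` B).

Definition independent_family f : Prop :=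
  forall (J : {fset nat * nat * V}) (B : nat * nat * V -> set (config V)),
    (P (\bigcap_(k in [set` J]) (f k @^-1` B k)) =
     \prod_(k <- J) P (f k @^-1` B k))%E.

Definition edge_breeding_offspring (lam : R) f : Prop :=
  [/\ measurable_family f,
      independent_family f &
      forall n i x (z : V -> R), (forall y, 0 <= z y <= 1) ->
        'E_P[fun w => config_weight z (f (n, i, x) w)]%E =
        (edge_breeding_gf lam z x)%:E].

(* [brw f x n] is the configuration eta_n of generation n, when generation 0
   consists of a single particle at x: each of the particles of generation n is
   replaced by its children. *)
Fixpoint brw f (x : V) (n : nat) (w : Omega) : config V :=
  if n is n'.+1 then
    let c := brw f x n' w in
    \big[msetD/mset0]_(u <- finsupp c) \big[msetD/mset0]_(i < c u)
      f (n', (i : nat), u) w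
  else [mset x]%mset.

(* q(x, A) = 1 - P^{delta_x}(limsup_n sum_(y in A) eta_n(y) > 0) *)
Definition extinction_probability f (A : set V) (x : V) : R :=
  1 - fine (P [set w |
    (0 < limn_esup (fun n => \esum_(y in A) ((brw f x n w y)%:R : R)%:E))%E]).

End BranchingRandomWalk.

(* Main.v *)
Require Import Defs.
From HB Require Import structures.
From mathcomp Require Import all_boot all_order all_algebra.
From mathcomp Require Import finmap multiset.
From mathcomp Require Import all_classical all_reals all_analysis.
From mathcomp Require Import measurable_realfun.
From mathcomp Require Import zify lra.

Set Implicit Arguments.
Unset Strict Implicit.
Unset Printing Implicit Defensive.

Import Order.TTheory GRing.Theory Num.Theory.

Local Open Scope classical_set_scope.
Local Open Scope ring_scope.

(** The two sums differ only if the index sets differ, so some i belongs to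
    exactly one of them, say to I1.  Put v = x_i and T = subtree o v.  The
    subtrees at the x_j are pairwise disjoint, so T lies inside the first union
    and misses the second.  It is enough to start the process at a vertex w of
    T far away from v and to compare:

    - the process started at w hits v with probability at most h(w), where
      h(u) = 2^(-d(u,v)/2).  At each vertex u of T other than v one neighbor is
      closer to v and two are farther, so
      lam * sum_(y ~ u) h(y) = 2 sqrt 2 * lam * h(u) <= h(u)
      exactly when lam <= 1 / (2 sqrt 2).  While v has not been hit, the
      process stays in T minus v (lemma [avoidance_subharmonic], through
      [confined_ge]);
    - the process dies out with probability at most s = 1 / (3 lam) < 1, the
      fixed point of s |-> 1 / (1 + 3 lam (1 - s)) (lemma [dies_le]).

    Hence from w the second union is visited infinitely often with probability
    at most h(w) (lemma [extinction_ge]), and the first one with probability at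
    least 1 - h(w) - s (lemma [extinction_le]).  As w moves away from v, h(w)
    tends to 0 and the two extinction probabilities separate.

    Both bounds come from one identity.  For z : V -> [0, 1], write W_n(z) for
    the product of z over the particles of generation n, and gf z for the
    offspring generating function at z.  On an event decided by the first n
    generations, W_(n+1)(z) and W_n(gf z) have the same integral (lemma
    [integral_weightS]).  A z with z <= gf z therefore gives a submartingale,
    and a z with z = gf z a martingale.  This is where the branching structure
    enters, and it rests on the independence of the offspring of generation n
    from the past, obtained in [indep_history] by cutting events of the past
    into countably many pieces on which everything is constant. *)

(** * Geometry of the regular tree *)

Section TreeGeometry.
Variables (V : countType) (adj : rel V).
Hypothesis hT3 : is_T3 adj.

Let adj_sym : symmetric adj. Proof. by case: hT3. Qed.
Let adj_irr : irreflexive adj. Proof. by case: hT3. Qed.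

(** Membership in a subtree and distances are all reduced to this relation:
    by acyclicity, removing a vertex separates its neighbors
    (lemma [neighbors_unlinked]), which replaces uniqueness of simple paths. *)
Definition linked_avoiding (v u w : V) : Prop :=
  exists p, [/\ path adj u p, last u p = w & v \notin u :: p].

Lemma linked_avoiding_sym v u w :
  linked_avoiding v u w -> linked_avoiding v w u.
Proof.
case=> p [pp lp vp]; exists (rev (belast u p)); split.
- rewrite -lp rev_path; apply: sub_path pp => a b /=.
  by rewrite adj_sym.
- by case: p lp {pp vp} => //= a p _; rewrite rev_cons last_rcons.
- by rewrite -lp -rev_rcons -lastI mem_rev.
Qed.

Lemma linked_avoiding_trans v u w t :
  linked_avoiding v u w -> linked_avoiding v w t -> linked_avoiding v u t.
Proof.
case=> p [pp lp vp] [q [qq lq vq]]; exists (p ++ q); split.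
- by rewrite cat_path pp lp.
- by rewrite last_cat lp.
- rewrite -cat_cons mem_cat negb_or vp /=.
  by move: vq; rewrite inE negb_or => /andP[].
Qed.

Lemma linked_avoiding_step v u w t :
  linked_avoiding v u w -> adj w t -> v <> t -> linked_avoiding v u t.
Proof.
move=> /[dup] -[p [pp lp vp]] uw wt vt; apply: linked_avoiding_trans uw _.
exists [:: t]; split; rewrite /= ?wt // !inE negb_or; apply/andP; split.
  by apply: contraNneq vp => ->; rewrite -lp mem_last.
by apply/eqP.
Qed.

(** Otherwise a simple path from a to b, closed through x, is a cycle. *)
Lemma neighbors_unlinked x a b :
  adj x a -> adj x b -> linked_avoiding x a b -> a = b.
Proof.
case: hT3 => _ _ _ _ acyclic xa xb [p [pp lp xp]].
apply/eqP/negPn/negP => ab.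
case/shortenP: pp lp xp => p' p'p up' sp' lp xp.
have xp' : x \notin a :: p'.
  apply: contraNN xp; rewrite !inE => /orP[->//|/sp' ->].
  by rewrite orbT.
apply: (acyclic (x :: a :: p')).
  by case: p' lp {p'p up' sp' xp'} => //= lp; rewrite lp eqxx in ab.
rewrite /ucycle /= xa rcons_path p'p lp -/(adj b x) adj_sym xb /=.
by move: up' => /= ->; rewrite andbT.
Qed.

(** Unlike the definition of [subtree], which speaks of one simple path, the
    right-hand side speaks of all walks from o, hence it passes to
    neighbors at once.  For the direct implication, a walk from o to w avoiding
    v would link the predecessor and the successor of v on the simple path
    through v. *)
Lemma subtreeP o v w : subtree adj o v w <-> ~ linked_avoiding v o w.
Proof.
split=> [[p [pp up lp vp]] ow|Now].
  have vo : v <> o.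
    by case: ow => q [_ _]; rewrite inE negb_or => /andP[/eqP].
  move: vp; rewrite inE => /orP[/eqP //|/splitPr vp].
  case: vp pp up lp => p1 [|b p2].
    rewrite cats1 last_rcons => _ _ vw; case: ow => q [_ lq].
    by rewrite vw -lq mem_last.
  rewrite cat_path => /= /and4P[pp1 av vb bp2].
  rewrite mem_cat cat_uniq !inE /= !inE !negb_or.
  case/and3P => /and4P[_ _ ob _] _.
  move=> /and3P[/and3P[vp1 bp1 _] /andP[vb' vp2] _].
  rewrite last_cat /= => lp.
  have oa : linked_avoiding v o (last o p1).
    by exists p1; split=> //; rewrite inE negb_or vp1 andbT; apply/eqP.
  have bw : linked_avoiding v b w.
    by exists p2; split=> //; rewrite inE negb_or vb' vp2.
  have ab : last o p1 = b.
    apply: (@neighbors_unlinked v) => //; first by rewrite adj_sym.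
    apply: linked_avoiding_trans (linked_avoiding_sym oa) _.
    exact: linked_avoiding_trans ow (linked_avoiding_sym bw).
  have : b \in o :: p1 by rewrite -ab mem_last.
  by rewrite inE eq_sym (negbTE ob) (negbTE bp1).
case: hT3 => _ _ _ /(_ o w)[p [pp lp]] _.
case/shortenP: pp lp => q qq uq _ lq.
exists q; split=> //; apply/negPn/negP => vq; apply: Now.
by exists q.
Qed.

Lemma subtree_closed o v u w :
  subtree adj o v u -> u <> v -> adj u w -> subtree adj o v w.
Proof.
move=> /subtreeP Tu uv uw; apply/subtreeP => ow; apply: Tu.
by apply: linked_avoiding_step ow _ (nesym uv); rewrite adj_sym.
Qed.

Lemma subtree_root o v : subtree adj o v v.
Proof. by apply/subtreeP => -[p [_ <-]]; rewrite mem_last. Qed.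

(** On the simple path from o through v to w, the part after v either avoids
    v', so that v' can be avoided on the way from o to w via v, or contains v',
    and then v can be avoided via v'. *)
Lemma subtree_disjoint o v v' w : v <> v' ->
  linked_avoiding v o v' -> linked_avoiding v' o v ->
  subtree adj o v w -> ~ subtree adj o v' w.
Proof.
move=> vv' ov' ov Tv /subtreeP Tv'.
have /subtreeP Nvw := Tv; case: Tv => p [pp up lp vp].
have vo : v <> o.
  by case: ov' => q [_ _]; rewrite inE negb_or => /andP[/eqP].
move: vp; rewrite inE => /orP[/eqP //|/splitPr vp].
case: vp pp up lp => p1 p2; rewrite cat_path => /= /and3P[pp1 _ pp2].
rewrite cat_uniq /= => /andP[_ /and4P[_ _ vp2 _]].
rewrite last_cat /= => lp.
have [v'p2|v'p2] := boolP (v' \in p2).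
  apply: Nvw; apply: linked_avoiding_trans ov' _.
  case/splitPr: v'p2 pp2 vp2 lp => q1 q2.
  rewrite cat_path mem_cat last_cat /= inE !negb_or => /and3P[_ _ pq2].
  move=> /and3P[_ vv'' vq2] lq2.
  by exists q2; split=> //; rewrite inE negb_or vv''.
apply: Tv'; apply: linked_avoiding_trans ov _.
exists p2; split=> //; rewrite inE negb_or v'p2 andbT.
by apply/eqP/nesym.
Qed.

Lemma dist_ex u v : exists k, is_dist adj u v k.
Proof.
have ex : exists k,
    `[< exists p, [/\ path adj u p, last u p = v & size p = k] >].
  case: hT3 => _ _ _ /(_ u v)[p [pp lp]] _.
  by exists (size p); apply/asboolP; exists p.
case: (ex_minnP ex) => k /asboolP pk mk; exists k; split=> // p pp lp.
by apply: mk; apply/asboolP; exists p.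
Qed.

Definition tree_dist u v : nat := projT1 (cid (dist_ex u v)).

Lemma distP u v : is_dist adj u v (tree_dist u v).
Proof. exact: projT2 (cid (dist_ex u v)). Qed.

Lemma dist_gt0 u v : u <> v -> (0 < tree_dist u v)%N.
Proof.
move=> uv; have [[p [_ lp sp]] _] := distP u v.
by rewrite -sp; case: p lp {sp}.
Qed.

Lemma distxx u : tree_dist u u = 0%N.
Proof. by have [_ /(_ [::] isT erefl)] := distP u u; rewrite leqn0 => /eqP. Qed.

Lemma dist_step u w v : adj u w -> (tree_dist u v <= (tree_dist w v).+1)%N.
Proof.
move=> uw; have [[p [pp lp sp]] _] := distP w v.
have [_ /(_ (w :: p))] := distP u v.
by rewrite /= uw pp lp sp; exact.
Qed.

(** A geodesic from a that came back to x would be longer than d(x, v). *)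
Lemma geodesic_avoids x a v : adj x a -> (tree_dist a v <= tree_dist x v)%N ->
  linked_avoiding x a v.
Proof.
move=> xa ax; have [[p [pp lp sp]] _] := distP a v.
exists p; split=> //; rewrite inE negb_or; apply/andP; split.
  by apply: contraTneq xa => ->; rewrite adj_irr.
apply/negP => /splitPr xp; case: xp pp lp sp => p1 p2.
rewrite cat_path last_cat size_cat /= => /and3P[_ _ pp2] lp sp.
have [_ /(_ p2 pp2 lp)] := distP x v.
by move: ax; rewrite -sp; lia.
Qed.

(** Two such neighbors would be linked through v by geodesics avoiding x. *)
Lemma unique_nonfarther x a b v : adj x a -> adj x b ->
  (tree_dist a v <= tree_dist x v)%N -> (tree_dist b v <= tree_dist x v)%N ->
  a = b.
Proof.
move=> xa xb ha hb; apply: (@neighbors_unlinked x) => //.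
apply: linked_avoiding_trans (geodesic_avoids xa ha) _.
exact/linked_avoiding_sym/geodesic_avoids.
Qed.

Lemma neighborsP u : exists a b c,
  uniq [:: a; b; c] /\ forall y, (y \in [:: a; b; c]) = adj u y.
Proof.
case: hT3 => _ _ /(_ u)[s [us ss sP]] _ _.
by case: s us ss sP => [|a [|b [|c [|? ?]]]] // us _ sP; exists a, b, c.
Qed.

(** The neighbor closer to v contributes the first term, the other two are
    farther from v; this is where the degree 3 enters the upper bound
    on lam. *)
Lemma sum_pow_dist_le (R : realFieldType) (t : R) x v a b c :
  0 <= t <= 1 -> x <> v ->
  uniq [:: a; b; c] -> (forall y, (y \in [:: a; b; c]) = adj x y) ->
  \sum_(y <- [:: a; b; c]) t ^+ tree_dist y v <=
  t ^+ (tree_dist x v).-1 + t ^+ (tree_dist x v).+1 + t ^+ (tree_dist x v).+1.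
Proof.
move=> /andP[t0 t1] xv uabc abc.
have near y : adj x y -> t ^+ tree_dist y v <= t ^+ (tree_dist x v).-1.
  move=> xy; apply: ler_wiXn2l => //.
  by have := @dist_step x y v xy; lia.
have far y : ((tree_dist x v).+1 <= tree_dist y v)%N ->
    t ^+ tree_dist y v <= t ^+ (tree_dist x v).+1.
  exact: ler_wiXn2l.
have [xa xb xc] : [/\ adj x a, adj x b & adj x c].
  by split; rewrite -abc !inE eqxx ?orbT.
have := near _ xa; have := near _ xb; have := near _ xc.
have : t ^+ (tree_dist x v).+1 <= t ^+ (tree_dist x v).-1.
  by apply: ler_wiXn2l => //; lia.
rewrite !big_cons big_nil.
move: uabc; rewrite /= !inE negb_or => /and3P[/andP[ab ac] bc _].
case: (leqP (tree_dist a v) (tree_dist x v)) => [ha|/far ha];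
case: (leqP (tree_dist b v) (tree_dist x v)) => [hb|/far hb];
case: (leqP (tree_dist c v) (tree_dist x v)) => [hc|/far hc]; try lra.
- by rewrite (unique_nonfarther xa xb ha hb) eqxx in ab.
- by rewrite (unique_nonfarther xa xb ha hb) eqxx in ab.
- by rewrite (unique_nonfarther xa xc ha hc) eqxx in ac.
- by rewrite (unique_nonfarther xb xc hb hc) eqxx in bc.
Qed.

(** Among any two neighbors of a vertex other than v, one is farther from v
    and remains in the subtree; at v itself two neighbors outside of the subtree
    would be linked through o. *)
Lemma subtree_deep o v k : exists w, subtree adj o v w /\ (k <= tree_dist w v)%N.
Proof.
elim: k => [|k [u [Tu ku]]]; first by exists v; split=> //; exact: subtree_root.
have [a [b [c [uabc abc]]]] := neighborsP u.
have [ua ub] : adj u a /\ adj u b by rewrite -!abc !inE !eqxx ?orbT.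
have ab : a <> b.
  by move=> ab; move: uabc; rewrite ab /= !inE eqxx.
have [uv|uv] := eqVneq u v.
  have away y : adj u y -> (k.+1 <= tree_dist y v)%N.
    move=> uy; apply: leq_ltn_trans ku _; rewrite uv distxx; apply: dist_gt0.
    by move=> yv; move: uy; rewrite yv uv adj_irr.
  have [Ta|/subtreeP Ta] := pselect (subtree adj o v a).
    by exists a; split=> //; exact: away.
  exists b; split; last exact: away.
  apply/subtreeP => ob; apply: ab; apply: (@neighbors_unlinked u) => //.
  move/contrapT: Ta => oa; rewrite uv.
  exact: linked_avoiding_trans (linked_avoiding_sym oa) ob.
have Tn y : adj u y -> subtree adj o v y.
  by apply: subtree_closed => //; apply/eqP.
case: (leqP (tree_dist a v) (tree_dist u v)) => [ha|ha]; last first.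
  by exists a; split; [exact: Tn|exact: leq_ltn_trans ku ha].
case: (leqP (tree_dist b v) (tree_dist u v)) => [hb|hb]; last first.
  by exists b; split; [exact: Tn|exact: leq_ltn_trans ku hb].
by exfalso; apply: ab; exact: (unique_nonfarther ua ub ha hb).
Qed.

End TreeGeometry.

(** * The ray and the subtrees hanging from it *)

Section Ray.
Variables (V : countType) (adj : rel V).
Hypothesis hT3 : is_T3 adj.
Variables (o : V) (y : int -> V).
Hypothesis y_inj : injective y.
Hypothesis y_adj : forall n : int, adj (y n) (y (n + 1)).
Hypothesis y_dist : forall n : int, is_dist adj o (y n) `|n|%N.
Variable (x : nat -> V).
Hypothesis x_third : forall i : nat, (0 < i)%N ->
  [/\ adj (y (i%:Z - 1)) (x i), x i <> y (i%:Z - 2) & x i <> y i%:Z].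

Let adj_sym : symmetric adj. Proof. by case: hT3. Qed.
Let adj_irr : irreflexive adj. Proof. by case: hT3. Qed.

Lemma adj_dist_le u w m n : is_dist adj o u m -> is_dist adj o w n ->
  adj u w -> (n <= m.+1)%N.
Proof.
move=> [[p [pp lp sp]] _] [_ mn] uw.
have := mn (rcons p w); rewrite rcons_path pp lp uw last_rcons size_rcons sp.
by apply.
Qed.

(** Distances to o leave only y_(i-2), y_(i-1) and y_i as candidates. *)
Lemma third_not_on_ray i k : (0 < i)%N -> x i <> y k%:Z.
Proof.
move=> i0 xy; have [yx x2 x0] := x_third i0.
have d1 := y_dist (i%:Z - 1); have d2 := y_dist k%:Z.
have h1 := adj_dist_le d1 d2; have h2 := adj_dist_le d2 d1.
rewrite -xy in h1 h2; rewrite adj_sym in h2.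
have {}h1 := h1 yx; have {}h2 := h2 yx.
have [ki|[ki|ki]] : k%:Z = i%:Z - 1 \/ k%:Z = i%:Z \/ k%:Z = i%:Z - 2 by lia.
- by move: yx; rewrite xy ki adj_irr.
- by rewrite xy ki in x0.
- by rewrite xy ki in x2.
Qed.

Lemma root_on_ray : o = y 0.
Proof.
have [[p [_ <- sp]] _] := y_dist 0.
by case: p sp.
Qed.

Lemma ray_linked v (n m : nat) : (forall k : nat, v <> y k%:Z) ->
  linked_avoiding adj v (y n%:Z) (y (n + m)%N%:Z).
Proof.
move=> vy; elim: m => [|m IH].
  by exists [::]; split; rewrite //= ?addn0 // inE; apply/eqP.
apply: (linked_avoiding_step IH) => //.
have <- : (n + m)%N%:Z + 1 = (n + m.+1)%N%:Z by lia.
exact: y_adj.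
Qed.

(** If x_i = x_j, two distinct vertices of the ray are neighbors of x_i and are
    linked along the ray. *)
Lemma third_inj i j : (0 < i)%N -> (0 < j)%N -> x i = x j -> i = j.
Proof.
wlog ij : i j / (i < j)%N => [hw i0 j0 xij|i0 j0 xij].
  have [lt|lt|//] := ltngtP i j; first exact: hw.
  by apply/esym/hw.
have [yi _ _] := x_third i0; have [yj _ _] := x_third j0.
have e : y (i%:Z - 1) = y (j%:Z - 1).
  apply: (@neighbors_unlinked _ _ hT3 (x i)).
  - by rewrite adj_sym.
  - by rewrite adj_sym xij.
  - have := @ray_linked (x i) i.-1 (j - i) (fun k => @third_not_on_ray i k i0).
    have -> : i.-1%:Z = i%:Z - 1 by lia.
    by have -> : (i.-1 + (j - i))%N%:Z = j%:Z - 1 by lia.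
by move/y_inj: e; lia.
Qed.

Lemma third_linked i j : (0 < i)%N -> (0 < j)%N -> i <> j ->
  linked_avoiding adj (x i) o (x j).
Proof.
move=> i0 j0 ij; have [yj _ _] := x_third j0.
have := @ray_linked (x i) 0 j.-1 (fun k => @third_not_on_ray i k i0).
rewrite -root_on_ray add0n => /linked_avoiding_step; apply.
  by have -> : j.-1%:Z = j%:Z - 1 by lia.
by move=> /third_inj => /(_ i0 j0).
Qed.

Lemma third_subtrees_disjoint i j w : (0 < i)%N -> (0 < j)%N -> i <> j ->
  subtree adj o (x i) w -> ~ subtree adj o (x j) w.
Proof.
move=> i0 j0 ij; apply: subtree_disjoint => //.
- by move=> /third_inj => /(_ i0 j0).
- exact: third_linked.
- by apply: third_linked => //; exact: nesym.
Qed.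

End Ray.

(** * Independent families of discrete random variables *)

Section DiscreteIndependence.
Variables (R : realType) (K C : countType).
Variables (d : measure_display) (Omega : measurableType d).
Variable P : probability Omega R.
Variable X : K -> Omega -> C.
Hypothesis mX : forall k (B : set C), measurable (X k @^-1` B).
Hypothesis indX : forall (J : {fset K}) (B : K -> set C),
  (P (\bigcap_(k in [set` J]) (X k @^-1` B k)) =
   \prod_(k <- J) P (X k @^-1` B k))%E.

(** Independence is required of rectangles only: this is the form of the
    hypothesis on the family, it is stable under countable disjoint unions, and
    it is all that is needed since every event below is a countable union of
    rectangles. *)
Definition indep_of (S : set K) (H : set Omega) : Prop :=
  measurable H /\ forall (J : {fset K}) (B : K -> set C), [set` J] `<=` S ->
  (P (H `&` \bigcap_(k in [set` J]) (X k @^-1` B k)) =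
   P H * \prod_(k <- J) P (X k @^-1` B k))%E.

Lemma measurable_rectangle (J : {fset K}) (B : K -> set C) :
  measurable (\bigcap_(k in [set` J]) (X k @^-1` B k)).
Proof. by apply: fin_bigcap_measurable => // k _; exact: mX. Qed.

Lemma indepT S : indep_of S setT.
Proof. by split=> // J B _; rewrite setTI indX probability_setT mul1e. Qed.

Lemma indep0 S : indep_of S set0.
Proof. by split=> // J B _; rewrite set0I measure0 mul0e. Qed.

Lemma indepS S S' H : S' `<=` S -> indep_of S H -> indep_of S' H.
Proof. by move=> SS [mH iH]; split=> // J B /subset_trans/(_ SS)/iH. Qed.

Lemma indep_preimage S H k B : indep_of S H -> S k ->
  P (H `&` X k @^-1` B) = (P H * P (X k @^-1` B))%E.
Proof.
move=> [mH iH] Sk; have := iH [fset k]%fset (fun=> B).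
rewrite set_fset1 bigcap_set1 big_seq_fset1; apply.
by move=> _ /= ->.
Qed.

Lemma indep_setI S H k B : indep_of S H -> S k ->
  indep_of (S `\ k) (H `&` X k @^-1` B).
Proof.
move=> iSH Sk; split; first by apply: measurableI => //; case: iSH.
move=> J D JS; rewrite (indep_preimage _ iSH Sk).
have kJ : k \notin J by apply/negP => /JS[_ /(_ erefl)].
have [_ /(_ (k |` J)%fset (fun j => if j == k then B else D j))] := iSH.
have agree j : j \in J -> (if j == k then B else D j) = D j.
  by case: eqP => // ->; rewrite (negbTE kJ).
rewrite big_fsetU1 //= eqxx (eq_big_seq (fun j => P (X j @^-1` D j))); last first.
  by move=> j /agree ->.
rewrite muleA => <-; last first.
  by move=> j /=; rewrite !inE => /orP[/eqP -> //|/JS[]].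
congr (P _); rewrite set_fsetU1 bigcap_setU1 eqxx setIA; congr (_ `&` _).
by apply: eq_bigcapr => j /agree ->.
Qed.

Lemma indep_bigcup S (F : nat -> set Omega) : trivIset setT F ->
  (forall n, indep_of S (F n)) -> indep_of S (\bigcup_n F n).
Proof.
move=> tF iF; have mF n : measurable (F n) by case: (iF n).
split=> [|J B JS]; first exact: bigcup_measurable.
have mB := measurable_rectangle J B.
rewrite setI_bigcupl !measure_semi_bigcup //; first last.
- by apply: bigcup_measurable => n _; exact: measurableI.
- by apply: trivIset_setIr.
- by move=> n; exact: measurableI.
- exact: bigcup_measurable.
have cfin : (\prod_(k <- J) P (X k @^-1` B k))%E \is a fin_num.
  by rewrite -indX fin_num_measure.
rewrite muleC -(fineK cfin) -nneseriesZl // (fineK cfin).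
apply: eq_eseriesr => n _; rewrite muleC; case: (iF n) => _ iFn.
exact: iFn.
Qed.

(** A fiber of a countable-valued map, indexed by the code of the value so that
    the nat-indexed countable sums and unions apply. *)
Lemma fiber_pickle (T : countType) (Y : Omega -> T) n :
  (exists c, (choice.pickle \o Y) @^-1` [set n] = Y @^-1` [set c]) \/
  (choice.pickle \o Y) @^-1` [set n] = set0.
Proof.
have [[c <-]|nc] := pselect (exists c : T, choice.pickle c = n).
  left; exists c; apply/seteqP; split=> w /=; last by move=> ->.
  exact: (pcan_inj choice.pickleK).
right; apply/seteqP; split=> w //= wn; apply: nc; by exists (Y w).
Qed.

Lemma setI_fibers (T : countType) (Y : Omega -> T) H :
  H = \bigcup_n (H `&` (choice.pickle \o Y) @^-1` [set n]).
Proof.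
by apply/seteqP; split=> w => [Hw|[n _ []//]]; exists (choice.pickle (Y w)).
Qed.

Lemma trivIset_fibers (T : countType) (Y : Omega -> T) H :
  trivIset setT (fun n => H `&` (choice.pickle \o Y) @^-1` [set n]).
Proof. by move=> m n _ _ [w [[_ /= <-] [_ /= <-]]]. Qed.

(** The working principle of this part: it is enough to prove independence
    after fixing the value of any countable-valued map. *)
Lemma indep_fibers S (T : countType) (Y : Omega -> T) H :
  (forall c, indep_of S (H `&` Y @^-1` [set c])) -> indep_of S H.
Proof.
move=> iH; rewrite (setI_fibers Y H); apply: indep_bigcup => [|n].
  exact: trivIset_fibers.
by have [[c ->]|->] := fiber_pickle Y n; rewrite ?setI0 //; exact: indep0.
Qed.

(** Once the values of the variables indexed by s are fixed one after the
    other, membership in [Phi] is decided. *)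
Lemma indep_section S H (s : seq K) (Phi : set (seq C)) :
  uniq s -> {subset s <= S} -> indep_of S H ->
  indep_of (S `\` [set` s]) (H `&` [set w | Phi [seq X k w | k <- s]]).
Proof.
elim: s => [|k s IH] /= in S H Phi * => [_ _ iH|/andP[ks us] sS iH].
  apply: (@indepS S); first by move=> ? [].
  have [Phi0|Phi0] := pselect (Phi [::]).
    by rewrite (_ : [set _ | _] = setT) ?setIT //; apply/seteqP; split.
  rewrite (_ : [set _ | _] = set0) ?setI0 //; first exact: indep0.
  by apply/seteqP; split.
apply: (indep_fibers (Y := X k)) => c.
have Sk : S k by apply/set_mem/sS; rewrite mem_head.
have <- : S `\ k `\` [set` s] = S `\` [set` k :: s].
  apply/seteqP; split=> j /=; rewrite inE.
    by move=> [[Sj jk] js]; split=> // /orP[/eqP|].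
  move=> [Sj /negP]; rewrite negb_or => /andP[/eqP jk /negP js].
  by split.
have -> : H `&` [set w | Phi (X k w :: [seq X k0 w | k0 <- s])] `&`
      X k @^-1` [set c] =
    H `&` X k @^-1` [set c] `&` [set w | Phi (c :: [seq X k0 w | k0 <- s])].
  apply/seteqP; split=> w /=.
    by move=> [[Hw h1] h2]; rewrite -h2.
  by move=> [[Hw h1] h2]; rewrite h1.
apply: (IH _ _ (fun t => Phi (c :: t))) => //; last exact: indep_setI.
move=> j js; apply/mem_set; split.
  by apply/set_mem/sS; rewrite inE js orbT.
by move=> jk; move: ks; rewrite -jk js.
Qed.

Lemma measurable_fun_discrete (T : Type) (Y : Omega -> T) D (g : T -> R) :
  (forall B : set T, measurable (Y @^-1` B)) ->
  measurable_fun D (fun w => g (Y w)).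
Proof.
move=> mY mD B _; apply: measurableI => //.
by rewrite (_ : _ @^-1` B = Y @^-1` (g @^-1` B)).
Qed.

Lemma integral_fibers (T : countType) (Y : Omega -> T) H (F : Omega -> R) :
  (forall B : set T, measurable (Y @^-1` B)) ->
  measurable H -> measurable_fun setT F -> (forall w, 0 <= F w) ->
  (\int[P]_(w in H) (F w)%:E =
   \sum_(0 <= n <oo)
     \int[P]_(w in H `&` (choice.pickle \o Y) @^-1` [set n]) (F w)%:E)%E.
Proof.
move=> mY mH mF F0; rewrite {1}(setI_fibers Y H) ge0_integral_bigcup //.
- by move=> n; apply: measurableI => //; exact: (mY (choice.pickle @^-1` [set n])).
- by apply/measurable_EFinP; exact: measurable_funTS.
- by move=> w _; rewrite lee_fin.
- exact: trivIset_fibers.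
Qed.

(** Fix the value of the first variable, use the induction hypothesis on each
    piece, where that variable is a constant factor, and sum up again. *)
Lemma indep_integral_prod S H (s : seq K) (g : K -> C -> R) (e : K -> R) :
  (forall k c, 0 <= g k c) -> (forall k, 0 <= e k) ->
  (forall k, k \in s -> (\int[P]_w (g k (X k w))%:E = (e k)%:E)%E) ->
  uniq s -> {subset s <= S} -> indep_of S H ->
  (\int[P]_(w in H) (\prod_(k <- s) g k (X k w))%:E =
   P H * (\prod_(k <- s) e k)%:E)%E.
Proof.
move=> g0 e0; elim: s => [|k s IH] in S H * => [_ _ _ [mH _]|ge].
  under eq_integral do rewrite big_nil.
  by rewrite integral_cst // big_nil mul1e mule1.
move=> /= /andP[ks us] sS iH; have mH : measurable H by case: iH.
have Sk : S k by apply/set_mem/sS; rewrite mem_head.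
have mg (t : seq K) : measurable_fun setT (fun w => \prod_(k <- t) g k (X k w)).
  by apply: measurable_prod => j _; apply: measurable_fun_discrete; exact: mX.
have mgk : measurable_fun setT (fun w => g k (X k w)).
  by apply: measurable_fun_discrete; exact: mX.
rewrite (integral_fibers (mX k)) //; last by move=> w; exact: prodr_ge0.
rewrite big_cons mulrC EFinM muleA -(ge k) ?mem_head //.
rewrite (integral_fibers (mX k) measurableT) //.
have Pfin : (P H * (\prod_(j <- s) e j)%:E)%E \is a fin_num.
  by rewrite fin_numM // fin_num_measure.
rewrite -(fineK Pfin) -nneseriesZl; last first.
- by move=> n _; apply: integral_ge0 => w _; rewrite lee_fin.
apply: eq_eseriesr => n _.
have [[c ->]|->] := fiber_pickle (X k) n; last first.
  by rewrite !setI0 !integral_set0 mule0.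
rewrite setTI (fineK Pfin).
transitivity (\int[P]_(w in H `&` X k @^-1` [set c])
    ((g k c)%:E * (\prod_(j <- s) g j (X j w))%:E))%E.
  by apply: eq_integral => w /set_mem[_ /= <-]; rewrite big_cons EFinM.
rewrite ge0_integralZl_EFin //; first last.
- by apply/measurable_EFinP; exact: measurable_funTS.
- by move=> w _; rewrite lee_fin; exact: prodr_ge0.
- by apply: measurableI => //; exact: mX.
rewrite (IH (S `\ k)) //; first last.
- exact: indep_setI.
- move=> j js; apply/mem_set; split.
    by apply/set_mem/sS; rewrite inE js orbT.
  by move=> jk; move: ks; rewrite -jk js.
- by move=> j js; apply: ge; rewrite inE js orbT.
rewrite (indep_preimage _ iH Sk).
transitivity (P H * (\prod_(j <- s) e j)%:E *
  \int[P]_(w in X k @^-1` [set c]) cst (g k c)%:E w)%E; last first.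
  by congr (_ * _)%E; apply: eq_integral => w /set_mem /= ->.
rewrite (integral_cst P (mX k _)).
by rewrite [RHS]muleCA muleAC.
Qed.

End DiscreteIndependence.

(** * Product weights of configurations *)

Section ConfigWeight.
Variables (R : realType) (V : countType).
Implicit Types (z : V -> R) (c : config V).

HB.instance Definition _ := Monoid.isLaw.Build {mset V}%mset mset0 msetD
  (@msetDA V) (@mset0D V) (@msetD0 V).

Lemma config_weight_enum z c : config_weight z c = \prod_(y <- c) z y.
Proof. by rewrite big_mset. Qed.

Lemma config_weight0 z : config_weight z mset0 = 1.
Proof. by rewrite config_weight_enum enum_mset0 big_nil. Qed.

Lemma config_weight1 z x : config_weight z [mset x]%mset = z x.
Proof. by rewrite config_weight_enum enum_msetn big_seq1. Qed.

Lemma config_weightD z a b :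
  config_weight z (a `+` b)%mset = config_weight z a * config_weight z b.
Proof.
rewrite !config_weight_enum -big_cat; apply: perm_big.
by apply/allP => y _ /=; rewrite count_cat !count_mem_mset msetE2.
Qed.

Lemma config_weight_sum z (I : Type) (s : seq I) (F : I -> config V) :
  config_weight z (\big[msetD/mset0]_(i <- s) F i) =
  \prod_(i <- s) config_weight z (F i).
Proof.
by rewrite (big_morph _ (config_weightD z) (config_weight0 z)).
Qed.

Lemma config_weight_ge0 z c : (forall y, 0 <= z y) -> 0 <= config_weight z c.
Proof. by move=> z0; apply: prodr_ge0 => y _; exact: exprn_ge0. Qed.

Lemma config_weight_le1 z c :
  (forall y, 0 <= z y <= 1) -> config_weight z c <= 1.
Proof.
move=> z01; rewrite config_weight_enum; apply: prodr_ile1 => y _; exact: z01.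
Qed.

Lemma le_config_weight z z' c : (forall y, 0 <= z y) ->
  (forall y, y \in c -> z y <= z' y) -> config_weight z c <= config_weight z' c.
Proof.
move=> z0 zz'; rewrite !config_weight_enum 2!big_seq; apply: ler_prod => y yc.
by rewrite z0 zz'.
Qed.

Lemma config_weight_eq0 z c y : y \in c -> z y = 0 -> config_weight z c = 0.
Proof.
move=> yc zy; rewrite config_weight_enum.
by rewrite (big_rem y yc) /= zy mul0r.
Qed.

Definition particles (n : nat) c : seq (nat * nat * V) :=
  [seq (n, i, u) | u <- finsupp c, i <- iota 0 (c u)].

Lemma big_particles (T : Type) (idx : T) (op : Monoid.law idx) n c
    (F : nat * nat * V -> T) :
  \big[op/idx]_(k <- particles n c) F k =
  \big[op/idx]_(u <- finsupp c) \big[op/idx]_(i < c u) F (n, i : nat, u).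
Proof.
rewrite big_allpairs_dep; apply: eq_bigr => u _.
by rewrite -(big_mkord xpredT (fun i => F (n, i, u))) /index_iota subn0.
Qed.

Lemma uniq_particles n c : uniq (particles n c).
Proof.
apply: allpairs_uniq_dep; rewrite ?fset_uniq //; first by move=> u _;
  exact: iota_uniq.
by move=> [u i] [u' i'] _ _ [-> ->].
Qed.

Lemma particles_generation n c k : k \in particles n c -> k.1.1 = n.
Proof. by case/allpairsPdep => u [i [_ _ ->]]. Qed.

Lemma config_weight_particles z n c :
  \prod_(k <- particles n c) z k.2 = config_weight z c.
Proof.
rewrite big_particles; apply: eq_bigr => u _ /=.
by rewrite prodr_const card_ord.
Qed.

End ConfigWeight.

(** * One generation of the branching random walk *)

Section BranchingProcess.
Variables (R : realType) (V : countType) (adj : rel V).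
Variables (d : measure_display) (Omega : measurableType d).
Variable P : probability Omega R.
Variables (lam : R) (f : nat * nat * V -> Omega -> config V).
Hypothesis lam0 : 0 < lam.
Hypothesis hf : edge_breeding_offspring adj P lam f.

Let mf k (B : set (config V)) : measurable (f k @^-1` B).
Proof. by case: hf => + _ _; apply. Qed.

Let indf (J : {fset nat * nat * V}) B :
  (P (\bigcap_(k in [set` J]) (f k @^-1` B k)) =
   \prod_(k <- J) P (f k @^-1` B k))%E.
Proof. by case: hf => _ + _; apply. Qed.

Local Notation gf := (edge_breeding_gf adj lam).

Lemma gfE z u a b c : uniq [:: a; b; c] ->
  (forall y, (y \in [:: a; b; c]) = adj u y) ->
  gf z u = (1 + lam * \sum_(y <- [:: a; b; c]) (1 - z y))^-1.
Proof.
move=> uabc abc; rewrite /edge_breeding_gf (fsbig_seq _ _ uabc).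
congr (1 + lam * _)^-1; apply: eq_fsbigl.
by apply/seteqP; split=> y /=; rewrite abc.
Qed.

Lemma gf_ge0 z u : (forall y, 0 <= z y <= 1) -> 0 <= gf z u.
Proof.
move=> z01; rewrite /edge_breeding_gf invr_ge0 addr_ge0 // mulr_ge0 //.
  exact: ltW.
by apply: fsumr_ge0 => y _; rewrite subr_ge0; case/andP: (z01 y).
Qed.

Variable x : V.
Local Notation eta := (brw f x).

Lemma brwS n w :
  eta n.+1 w = \big[msetD/mset0]_(k <- particles n (eta n w)) f k w.
Proof. by rewrite big_particles. Qed.

(** Events of the past of this form suffice: [U] is the whole space for the
    martingale bounding the probability of death, and the configurations living
    in a given set of vertices for the submartingale bounding the probability of
    leaving that set. *)
Definition confined_upto (U : set (config V)) (n : nat) : set Omega :=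
  [set w | forall m, (m <= n)%N -> U (eta m w)].

Definition from_generation (n : nat) : set (nat * nat * V) :=
  [set k | (n <= k.1.1)%N].

(** The event is decided by keys of generations before n.  Induction on n:
    after fixing the configuration c' of generation n, passing to generation
    n.+1 only looks at the finitely many keys of [particles n c']. *)
Lemma indep_history U n c :
  indep_of P f (from_generation n) (confined_upto U n `&` eta n @^-1` [set c]).
Proof.
elim: n c => [|n IH] c.
  have [[Ux xc]|nxc] := pselect (U [mset x]%mset /\ [mset x]%mset = c).
    rewrite (_ : _ `&` _ = setT); first exact: indepT.
    by apply/seteqP; split=> // w _; split=> //= -[].
  rewrite (_ : _ `&` _ = set0); first exact: indep0.
  by apply/seteqP; split=> // w [/= /(_ 0%N isT) h1 h2]; apply: nxc.
apply: (indep_fibers mf indf (Y := eta n)) => c'.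
pose Phi (t : seq (config V)) :=
  \big[msetD/mset0]_(e <- t) e = c /\ U c.
have -> : confined_upto U n.+1 `&` eta n.+1 @^-1` [set c] `&`
      eta n @^-1` [set c'] =
    (confined_upto U n `&` eta n @^-1` [set c']) `&`
    [set w | Phi [seq f k w | k <- particles n c']].
  apply/seteqP; split=> w.
    move=> [[wU ec] <-]; have {}ec : eta n.+1 w = c := ec.
    split; first by split=> // m mn; apply: wU; exact: leqW.
    by rewrite /Phi /= big_map -brwS ec; split=> //; rewrite -ec; exact: wU.
  move=> [[wU]]; rewrite /= => ec'; rewrite /Phi /= big_map -ec' -brwS => -[ec Uc].
  split=> //; split=> // m; rewrite leq_eqVlt => /orP[/eqP ->|]; last exact: wU.
  by rewrite ec.
apply: (@indepS _ _ _ _ _ _ _ (from_generation n `\` [set` particles n c'])).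
  move=> k /= nk; split; first exact: ltnW.
  by move/particles_generation => kn; rewrite /from_generation /= kn ltnn in nk.
apply: (indep_section mf indf) => //; first exact: uniq_particles.
by move=> k /particles_generation kn; apply/mem_set; rewrite /from_generation /= kn.
Qed.

Lemma measurable_confined_upto U n : measurable (confined_upto U n).
Proof.
by have [] := indep_fibers mf indf (Y := eta n) (indep_history U n).
Qed.

Lemma measurable_brw n B : measurable (eta n @^-1` B).
Proof.
suff [] : indep_of P f (from_generation n) (eta n @^-1` B) by [].
apply: (indep_fibers mf indf (Y := eta n)) => c; have [Bc|nBc] := pselect (B c).
  rewrite (_ : _ `&` _ = confined_upto setT n `&` eta n @^-1` [set c]).
    exact: indep_history.
  by apply/seteqP; split=> w /= [? ->].
rewrite (_ : _ `&` _ = set0); first exact: indep0.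
by apply/seteqP; split=> w //= [+ h]; rewrite h.
Qed.

Lemma measurable_weight n (z : V -> R) :
  measurable_fun setT (fun w => config_weight z (eta n w)).
Proof. by apply: measurable_fun_discrete; exact: measurable_brw. Qed.

(** The branching property in generating-function form: given the past, each
    particle at u multiplies the expected weight by [gf z u]. *)
Lemma integral_weightS U n (z : V -> R) : (forall y, 0 <= z y <= 1) ->
  (\int[P]_(w in confined_upto U n) (config_weight z (eta n.+1 w))%:E =
   \int[P]_(w in confined_upto U n) (config_weight (gf z) (eta n w))%:E)%E.
Proof.
move=> z01.
have z0 y : 0 <= z y by case/andP: (z01 y).
rewrite !(integral_fibers P (measurable_brw n) (measurable_confined_upto U n)); first last.
- by move=> w; exact: config_weight_ge0.
- exact: measurable_weight.
- by move=> w; apply: config_weight_ge0 => y; exact: gf_ge0.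
- exact: measurable_weight.
apply: eq_eseriesr => m _.
have [[c ->]|->] := fiber_pickle (eta n) m; last by rewrite setI0 !integral_set0.
have iH := indep_history U n c.
transitivity (\int[P]_(w in confined_upto U n `&` eta n @^-1` [set c])
    (\prod_(k <- particles n c) config_weight z (f k w))%:E)%E.
  apply: eq_integral => w /set_mem[_ /= <-].
  by rewrite -config_weight_sum -brwS.
rewrite (@indep_integral_prod _ _ _ _ _ P f mf (from_generation n) _
  (particles n c) (fun=> config_weight z) (fun k => gf z k.2)) //; first last.
- by move=> k /particles_generation kn; apply/mem_set; rewrite /from_generation /= kn.
- exact: uniq_particles.
- move=> [[m' i] u] _; case: hf => _ _ /(_ m' i u z z01).
  by rewrite expectation.unlock.
- by move=> k; exact: gf_ge0.
- by move=> _ c'; exact: config_weight_ge0.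
rewrite config_weight_particles muleC -integral_cst; last by case: iH.
by apply: eq_integral => w /set_mem[_ /= ->].
Qed.

End BranchingProcess.

(** * Confinement, death and visits of a set *)

Section Extinction.
Variables (R : realType) (V : countType) (adj : rel V).
Variables (d : measure_display) (Omega : measurableType d).
Variable P : probability Omega R.
Variables (lam : R) (f : nat * nat * V -> Omega -> config V).
Hypothesis lam0 : 0 < lam.
Hypothesis hf : edge_breeding_offspring adj P lam f.
Variable x : V.

Local Notation gf := (edge_breeding_gf adj lam).
Local Notation eta := (brw f x).

Let mw U n : measurable (confined_upto f x U n).
Proof. exact: measurable_confined_upto hf x U n. Qed.

Let mweight D n (z : V -> R) :
  measurable_fun D (fun w => (config_weight z (eta n w))%:E).
Proof.
apply/measurable_EFinP; apply: measurable_funTS.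
exact: measurable_weight hf x n z.
Qed.

Let integral_const (c : R) : (\int[P]__ c%:E = c%:E)%E.
Proof.
rewrite integral_cst // -[RHS]mule1; congr (_ * _)%E; exact: probability_setT.
Qed.

Definition supported (U : set V) : set (config V) :=
  [set c : config V | forall y : V, y \in c -> U y].

Definition confined (U : set V) : set Omega :=
  [set w | forall n, supported U (eta n w)].

Lemma confinedE U : confined U = \bigcap_n confined_upto f x (supported U) n.
Proof.
apply/seteqP; split=> w; first by move=> Uw n _ m _; exact: Uw.
by move=> Uw n; exact: (Uw n I n (leqnn n)).
Qed.

Lemma measurable_confined U : measurable (confined U).
Proof. by rewrite confinedE; apply: bigcap_measurable => // n _; exact: mw. Qed.

(** Since z vanishes off U, the weight vanishes as soon as a particle leaves U,
    so restricting to the event of confinement loses nothing, and z <= gf z on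
    the vertices actually occupied makes the integral of the weight over this
    event nondecreasing in n.  It starts at z x and is at most the probability
    of the event. *)
Lemma confined_ge (U : set V) (z : V -> R) :
  (forall y, 0 <= z y <= 1) -> (forall y, ~ U y -> z y = 0) ->
  (forall y, U y -> z y <= gf z y) -> ((z x)%:E <= P (confined U))%E.
Proof.
move=> z01 zU zgf; have z0 y : 0 <= z y by case/andP: (z01 y).
set W := confined_upto f x (supported U).
have weight_ge n :
    ((z x)%:E <= \int[P]_(w in W n) (config_weight z (eta n w))%:E)%E.
  elim: n => [|n IH].
    have [Ux|Ux] := pselect (U x); last first.
      by rewrite zU //; apply: integral_ge0 => w _; rewrite lee_fin config_weight_ge0.
    rewrite (_ : W 0%N = setT).
      under eq_integral do rewrite /= config_weight1.
      by rewrite integral_const.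
    apply/seteqP; split=> // w _ m; rewrite leqn0 => /eqP -> y /=.
    by rewrite in_mset1 => /eqP ->.
  (* the part of W n outside of W n.+1 carries a particle outside of U *)
  have -> : (\int[P]_(w in W n.+1) (config_weight z (eta n.+1 w))%:E =
      \int[P]_(w in W n) (config_weight z (eta n.+1 w))%:E)%E.
    rewrite integral_mkcond [RHS]integral_mkcond; apply: eq_integral => w _.
    rewrite !patchE; case: ifPn => [/set_mem Ww|nWw].
      by rewrite mem_set // => m mn; apply: Ww; exact: leqW.
    case: ifPn => // /set_mem Ww.
    have [Us|/existsNP[y /not_implyP[yc Uy]]] := pselect (supported U (eta n.+1 w)).
      case/negP: nWw; apply/mem_set => m; rewrite leq_eqVlt => /orP[/eqP -> //|].
      exact: Ww.
    by rewrite (config_weight_eq0 yc) // zU.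
  rewrite (integral_weightS lam0 hf) //; apply: (le_trans IH).
  apply: ge0_le_integral => //; first exact: mw.
    by move=> w _; rewrite lee_fin config_weight_ge0.
  move=> w Ww; rewrite lee_fin le_config_weight // => y yc.
  by apply: zgf; exact: (Ww n (leqnn n)).
have PW n : ((z x)%:E <= P (W n))%E.
  apply: (le_trans (weight_ge n)); rewrite -[leRHS]mul1e -integral_cst; last exact: mw.
  apply: ge0_le_integral => //; first exact: mw.
    by move=> w _; rewrite lee_fin config_weight_ge0.
  by move=> w _; rewrite lee_fin config_weight_le1.
have cW : (P \o W) n @[n --> \oo] --> P (confined U).
  rewrite confinedE; apply: nonincreasing_cvg_mu => //.
  - by apply: (le_lt_trans (probability_le1 _ _)) => //; [exact: mw|exact: ltry].
  - by move=> n; exact: mw.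
  - by have := measurable_confined U; rewrite confinedE.
  - move=> m n mn; apply/subsetPset => w Ww k km; apply: Ww.
    exact: leq_trans km mn.
rewrite -(cvg_lim _ cW) //; apply: lime_ge; first by apply/cvg_ex; eexists; exact: cW.
by apply: nearW => n; exact: PW.
Qed.

Definition dies : set Omega := [set w | exists n, eta n w = mset0].

Lemma diesE : dies = \bigcup_n (eta n @^-1` [set mset0]).
Proof. by apply/seteqP; split=> w [n]; [exists n|move=> _; exists n]. Qed.

Lemma measurable_dies : measurable dies.
Proof.
by rewrite diesE; apply: bigcup_measurable => n _; exact: measurable_brw hf x n _.
Qed.

(** The weight s ^ (number of particles) has constant integral s and is 1 on an
    empty generation. *)
Lemma dies_le (s : R) : 0 <= s <= 1 -> gf (fun=> s) = (fun=> s) ->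
  (P dies <= s%:E)%E.
Proof.
move=> s01 gfs.
have weight_const n : (\int[P]_w (config_weight (fun=> s) (eta n w))%:E = s%:E)%E.
  elim: n => [|n IH].
    under eq_integral do rewrite /= config_weight1.
    by rewrite integral_const.
  have WT : confined_upto f x setT n = setT by apply/seteqP; split.
  by have := integral_weightS lam0 hf x setT n (fun=> s01); rewrite WT gfs IH.
have Pn n : (P (eta n @^-1` [set mset0]) <= s%:E)%E.
  have m0 : measurable (eta n @^-1` [set mset0]) by exact: measurable_brw hf x n _.
  rewrite -(weight_const n) -[leLHS]mul1e -integral_cst //.
  rewrite (eq_integral (fun w => (config_weight (fun=> s) (eta n w))%:E)).
    apply: ge0_subset_integral => //.
    by move=> w _; rewrite lee_fin config_weight_ge0 // => y; case/andP: s01.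
  by move=> w /set_mem /= ->; rewrite config_weight0.
have cD : (P \o (fun n => eta n @^-1` [set mset0])) n @[n --> \oo] --> P dies.
  rewrite diesE; apply: nondecreasing_cvg_mu => //.
  - by move=> n; exact: measurable_brw hf x n _.
  - by have := measurable_dies; rewrite diesE.
  apply/nondecreasing_seqP => n; apply/subsetPset => w en.
  have {}en : eta n w = mset0 := en.
  by rewrite /preimage /= -/(brw f x n w) en finsupp0 big_seq_fset0.
rewrite -(cvg_lim _ cD) //; apply: lime_le; first by apply/cvg_ex; eexists; exact: cD.
by apply: nearW => n; exact: Pn.
Qed.

Definition visits (A : set V) : set Omega :=
  [set w | (0 < limn_esup (fun n => \esum_(y in A) ((eta n w y)%:R : R)%:E))%E].

(** The number of particles in A is a natural number, so that its upper limit
    is positive iff it is at least 1 infinitely often. *)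
Lemma visitsP A w :
  visits A w <-> forall N, exists2 n, (N <= n)%N & exists2 y, A y & y \in eta n w.
Proof.
rewrite /visits /= limn_esup_lim (cvg_lim _ (@cvg_esups_inf R _)) //.
have sum_ge0 n : (0 <= \esum_(y in A) ((eta n w y)%:R : R)%:E)%E.
  by apply: esum_ge0 => y _; rewrite lee_fin.
split=> [pos N|io].
  have {}pos : (0 < ereal_sup (sdrop
      (fun n => \esum_(y in A) ((eta n w y)%:R : R)%:E) N))%E.
    by apply: (lt_le_trans pos); apply: ereal_inf_lbound; exists N.
  apply: contrapT => no; move: pos; rewrite ltNge => /negP; apply.
  apply: ge_ereal_sup => _ [n /= Nn <-]; rewrite esum1 // => y Ay.
  congr (_%:E); apply/eqP; rewrite pnatr_eq0 mset_eq0; apply/negP => yn.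
  by apply: no; exists n => //; exists y.
apply: (@lt_le_trans _ _ 1%E); first exact: lte01.
apply: le_ereal_inf_tmp => _ [N _ <-].
have [n Nn [y Ay yn]] := io N.
apply: (@le_trans _ _ (\esum_(y in A) ((eta n w y)%:R : R)%:E)%E).
  apply: esum_ge; exists [set y].
    by split=> //; move=> _ ->.
  by rewrite fsbig_set1 lee_fin ler1n mset_gt0.
by apply: ereal_sup_ubound; exists n.
Qed.

Lemma measurable_visits A : measurable (visits A).
Proof.
rewrite (_ : visits A = \bigcap_N \bigcup_(n in [set n | (N <= n)%N])
    (eta n @^-1` [set c | exists2 y, A y & y \in c])).
  apply: bigcap_measurable => // N _; apply: bigcup_measurable => n _.
  exact: measurable_brw hf x n _.
apply/seteqP; split=> w.
  by move=> /visitsP vA N _; have [n Nn yn] := vA N; exists n.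
by move=> vA; apply/visitsP => N; have [n Nn yn] := vA N I; exists n.
Qed.

Let fineP A : measurable A -> (fine (P A))%:E = P A.
Proof. by move=> mA; rewrite fineK // fin_num_measure. Qed.

(** A process confined to U never visits A. *)
Lemma extinction_ge (A U : set V) (p : R) : A `&` U = set0 ->
  (p%:E <= P (confined U))%E -> p <= extinction_probability P f A x.
Proof.
move=> AU0 pU; rewrite /extinction_probability -/(visits A).
have mA := measurable_visits A; have mU := measurable_confined U.
rewrite lerBrDl -lerBrDr.
rewrite -lee_fin fineP //.
have : (P (visits A) <= P (~` confined U))%E.
  apply: le_measure; rewrite ?inE //; first exact: measurableC.
  move=> w /visitsP /(_ 0%N)[n _ [y Ay yn]] Uw.
  by have : set0 y by rewrite -AU0; split=> //; exact: (Uw n).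
move/le_trans; apply; rewrite probability_setC // EFinB.
exact: leeB.
Qed.

(** A process that is confined to U and does not die visits A in every
    generation. *)
Lemma extinction_le (A U : set V) (p s : R) : U `<=` A ->
  (p%:E <= P (confined U))%E -> (P dies <= s%:E)%E ->
  extinction_probability P f A x <= 1 - p + s.
Proof.
move=> UA pU sD; rewrite /extinction_probability -/(visits A).
have mA := measurable_visits A; have mU := measurable_confined U.
have mD := measurable_dies.
have : (P (confined U) <= P (visits A `|` dies))%E.
  apply: le_measure; rewrite ?inE //; first exact: measurableU.
  move=> w Uw; have [|nD] := pselect (dies w); first by right.
  left; apply/visitsP => N; exists N => //.
  apply: contrapT => no; apply: nD; exists N; apply/msetP => y.
  rewrite mset0E; apply/eqP; rewrite mset_eq0; apply/negP => yN.
  by apply: no; exists y => //; apply: UA; exact: (Uw N).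
move=> UAD; have {}UAD := le_trans UAD (measureU2 P mA mD).
have : (p%:E <= (fine (P (visits A)))%:E + s%:E)%E.
  by rewrite (fineP mA); apply: (le_trans (le_trans pU UAD)); exact: leeD2l.
by rewrite -EFinD lee_fin; lra.
Qed.

End Extinction.

(** * Separating two sets by a subtree *)

Section SubtreeDetection.
Variables (R : realType) (V : countType) (adj : rel V).
Hypothesis hT3 : is_T3 adj.
Variables (lam : R).
Hypothesis lam_gt : 3^-1 < lam.
Hypothesis lam_le : lam <= (2 * Num.sqrt 2)^-1.

Local Notation gf := (edge_breeding_gf adj lam).

Let lam0 : 0 < lam. Proof. by apply: lt_trans lam_gt; rewrite invr_gt0. Qed.

(** The value of t minimizing (t^-1 + 2 t), so that the condition
    lam (t^-1 + 2 t) <= 1 becomes the bound 1 / (2 sqrt 2) on lam. *)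
Definition decay : R := (Num.sqrt 2)^-1.

Lemma decay_gt0 : 0 < decay.
Proof. by rewrite invr_gt0 sqrtr_gt0. Qed.

Lemma decay_sqr : decay * decay = 2^-1.
Proof. by rewrite -invfM -expr2 sqr_sqrtr. Qed.

Lemma decay_lt1 : decay < 1.
Proof.
rewrite -(@ltr_pXn2r _ 2) ?nnegrE ?(ltW decay_gt0) // expr1n expr2 decay_sqr.
by rewrite invf_lt1 // ltr1n.
Qed.

Lemma lam_decay : 2 * lam <= decay.
Proof. by move: lam_le; rewrite invfM -/decay; lra. Qed.

(** A lower bound for the probability, starting at u, of remaining forever in
    the subtree without hitting its root v. *)
Definition avoidance (o v u : V) : R :=
  if `[< (subtree adj o v `\ v) u >] then 1 - decay ^+ tree_dist hT3 u v else 0.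

Let pow01 n : 0 <= decay ^+ n <= 1.
Proof.
by rewrite exprn_ge0 ?exprn_ile1 // ?(ltW decay_gt0) // (ltW decay_lt1).
Qed.

Lemma avoidance01 o v u : 0 <= avoidance o v u <= 1.
Proof.
rewrite /avoidance; case: ifP => _; last by rewrite lexx ler01.
by have /andP[? ?] := pow01 (tree_dist hT3 u v); apply/andP; split; lra.
Qed.

(** With h = decay ^ d(u, v), the sum over the neighbors gives
    1 / (1 + lam * S) >= 1 / (1 + h) >= 1 - h. *)
Lemma avoidance_subharmonic o v u : (subtree adj o v `\ v) u ->
  avoidance o v u <= gf (avoidance o v) u.
Proof.
move=> Tu; have [Tvu uv] := Tu.
have [a [b [c [uabc abc]]]] := neighborsP hT3 u.
rewrite (gfE _ _ uabc abc).
have -> : \sum_(y <- [:: a; b; c]) (1 - avoidance o v y) =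
    \sum_(y <- [:: a; b; c]) decay ^+ tree_dist hT3 y v.
  apply: eq_big_seq => y; rewrite abc => uy; rewrite /avoidance.
  have Ty : subtree adj o v y by exact: subtree_closed Tvu uv uy.
  case: asboolP => [_|nTy]; first by rewrite opprB addrC subrK.
  have -> : y = v by apply: contrapT => yv; apply: nTy.
  by rewrite distxx expr0 subr0.
have d01 : 0 <= decay <= 1 by rewrite (ltW decay_gt0) (ltW decay_lt1).
have sum_le := sum_pow_dist_le hT3 d01 uv uabc abc.
have sum_ge : 0 <= \sum_(y <- [:: a; b; c]) decay ^+ tree_dist hT3 y v.
  by apply: sumr_ge0 => y _; case/andP: (pow01 (tree_dist hT3 y v)).
rewrite /avoidance asboolT //.
have dpos := dist_gt0 hT3 uv.
set S := \sum_(y <- _) _ in sum_le sum_ge *.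
have SM : lam * S <= decay ^+ tree_dist hT3 u v.
  move: sum_le; rewrite -(prednK dpos) /= !exprS.
  set m := decay ^+ _; move=> sum_le.
  have m0 : 0 <= m by case/andP: (pow01 (tree_dist hT3 u v).-1).
  have SM2 : S <= 2 * m by move: sum_le; rewrite !mulrA decay_sqr; lra.
  apply: (@le_trans _ _ (2 * lam * m)); last exact: ler_wpM2r lam_decay.
  by rewrite -mulrA mulrCA; apply: ler_wpM2l => //; exact: ltW.
have /andP[h0 h1] := pow01 (tree_dist hT3 u v).
have p0 : 0 <= lam * S by apply: mulr_ge0 => //; exact: ltW.
rewrite -[leRHS]mul1r ler_pdivlMr; last by lra.
set h := decay ^+ _ in SM h0 h1 *; set p := lam * S in SM p0 *.
nra.
Qed.

Lemma gf_const (s := (3 * lam)^-1) : gf (fun=> s) = (fun=> s).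
Proof.
apply/funext => u; have [a [b [c [uabc abc]]]] := neighborsP hT3 u.
rewrite (gfE _ _ uabc abc) !big_cons big_nil ; congr (_^-1).
have : 3 * lam * s = 1 by rewrite divff // gt_eqF // mulr_gt0.
lra.
Qed.

Variables (d : measure_display) (Omega : measurableType d).
Variables (P : probability Omega R) (f : nat * nat * V -> Omega -> config V).
Hypothesis hf : edge_breeding_offspring adj P lam f.

(** From a vertex deep in the subtree, surviving implies visiting A, except
    with small probability, whereas B can only be reached through v. *)
Lemma extinction_neq (o v : V) (A B : set V) :
  subtree adj o v `<=` A -> B `&` subtree adj o v = set0 ->
  extinction_probability P f A <> extinction_probability P f B.
Proof.
move=> TA BT qAB; set s := (3 * lam)^-1.
have s01 : 0 < s < 1.
  by rewrite invr_gt0 invf_lt1; move: lam_gt lam0; lra.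
have [k kP] : exists k, decay ^+ k.+1 < (1 - s) / 2.
  have d1 : `|decay| < 1 by rewrite ger0_norm ?decay_lt1 // ltW // decay_gt0.
  have e0 : 0 < (1 - s) / 2 by lra.
  have /cvgrPdist_lt /(_ _ e0)[N _ HN] := cvg_expr d1.
  exists N; have := HN N.+1 (leqnSn N).
  by rewrite /= sub0r normrN ger0_norm // exprn_ge0 // ltW // decay_gt0.
have [u [Tu ku]] := subtree_deep hT3 o v k.+1.
have Uu : (subtree adj o v `\ v) u.
  by split=> // uv; move: ku; rewrite uv distxx.
have conf : ((avoidance o v u)%:E <= P (confined f u (subtree adj o v `\ v)))%E.
  apply: (confined_ge lam0 hf) => [y|y ny|y Uy].
  - exact: avoidance01.
  - by rewrite /avoidance asboolF.
  - exact: avoidance_subharmonic.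
have qB := extinction_ge hf (A := B) _ conf.
have qA := extinction_le hf (A := A) _ conf
  (dies_le lam0 hf u _ gf_const).
have : decay ^+ tree_dist hT3 u v <= decay ^+ k.+1.
  by apply: ler_wiXn2l ku; [exact: ltW decay_gt0|exact: ltW decay_lt1].
move: qA qB; rewrite qAB /avoidance asboolT // -/s.
move=> /(_ (subset_trans (@subDsetl _ _ _) TA)) qA qB.
have {}qA := qA ltac:(by lra).
have {}qB := qB ltac:(by rewrite -subset0 -BT => y [By [Ty _]]).
lra.
Qed.

End SubtreeDetection.

Theorem theorem3p3 (R : realType)
  (V : countType) (adj : rel V) (hT3 : is_T3 adj)
  (o : V) (y : int -> V)
  (y_inj : injective y)
  (y_adj : forall n : int, adj (y n) (y (n + 1)))
  (y_dist : forall n : int, is_dist adj o (y n) `|n|%N)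
  (x : nat -> V)
  (x_third : forall i : nat, (0 < i)%N ->
     [/\ adj (y (i%:Z - 1)) (x i), x i <> y (i%:Z - 2) & x i <> y i%:Z])
  (lam : R) (lam_gt : 3^-1 < lam) (lam_le : lam <= (2 * Num.sqrt 2)^-1)
  (d : measure_display) (Omega : measurableType d) (P : probability Omega R)
  (f : nat * nat * V -> Omega -> {mset V}%mset)
  (hf : edge_breeding_offspring adj P lam f)
  (I1 I2 : set nat) (hI1 : ~ I1 0%N) (hI2 : ~ I2 0%N)
  (hsum : (\esum_(i in I1) ((2 ^- i : R)%:E) <>
           \esum_(i in I2) ((2 ^- i : R)%:E))%E) :
  extinction_probability P f (\bigcup_(i in I1) subtree adj o (x i)) <>
  extinction_probability P f (\bigcup_(i in I2) subtree adj o (x i)).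
Proof.
have differ (I J : set nat) i : ~ I 0%N -> ~ J 0%N -> I i -> ~ J i ->
    extinction_probability P f (\bigcup_(i in I) subtree adj o (x i)) <>
    extinction_probability P f (\bigcup_(i in J) subtree adj o (x i)).
  move=> I0 J0 Ii Ji.
  apply: (extinction_neq hT3 lam_gt lam_le hf (o := o) (v := x i)).
    by move=> w Tw; exists i.
  apply/seteqP; split=> // w [[j Jj Tj] Ti].
  have pos (k : nat) (K : set nat) : ~ K 0%N -> K k -> (0 < k)%N.
    by move=> K0 Kk; rewrite lt0n; apply/eqP => k0; rewrite k0 in Kk.
  apply: (third_subtrees_disjoint hT3 y_inj y_adj y_dist x_third _ _ _ Ti Tj).
  - exact: pos I0 Ii.
  - exact: pos J0 Jj.
  - by move=> ij; apply: Ji; rewrite ij.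
have [sub12|/existsNP[i /not_implyP[I1i I2i]]] := pselect (I1 `<=` I2); last first.
  exact: differ I1i I2i.
have [sub21|/existsNP[i /not_implyP[I2i I1i]]] := pselect (I2 `<=` I1); last first.
  exact/nesym/(differ _ _ _ hI2 hI1 I2i I1i).
by case: hsum; rewrite (_ : I1 = I2) //; apply/seteqP.
Qed.
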